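(* Let $G$ be a finite group with $|G|<72$. Then for each prime $p$ the finite spaces $\mathcal{S}_p(G)$ and $\mathcal{A}_p(G)$ are homotopy equivalent.
   Context: $\mathcal{S}_p(G)$ is the poset of non-trivial $p$-subgroups of $G$ ordered by inclusion, and $\mathcal{A}_p(G)$ is its subposet of non-trivial elementary abelian $p$-subgroups (both are empty if $p\nmid |G|$). A finite poset $X$ is regarded as a finite topological space whose open sets are its down-sets (subsets $U$ such that $x\in U$, $y\le x$ imply $y\in U$). With this topology, continuous maps are exactly order-preserving maps, and two continuous maps $f,g:X\to Y$ are homotopic if and only if there are order-preserving maps $f=f_0,f_1,\ldots,f_m=g:X\to Y$ such that $f_i$ and $f_{i+1}$ are comparable (pointwise) for each $i$. Homotopy equivalence is understood for these finite topological spaces (not for their order complexes). *)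

(* Defs.v *)
From HB Require Import structures.
From mathcomp Require Import all_boot all_order all_algebra.
From mathcomp Require Import all_fingroup all_solvable.
From mathcomp Require Import all_classical all_reals topology normedtype.

Set Implicit Arguments.
Unset Strict Implicit.
Unset Printing Implicit Defensive.

Import Order.TTheory GRing.Theory Num.Theory.
Import numFieldNormedType.Exports.

(* [downset_space T] is an alias of [T], so that no other topology that [T]
   may carry interferes. *)
Definition downset_space (d : Order.disp_t) (T : finPOrderType d) : Type := T.

Section DownsetTopology.
Local Open Scope classical_set_scope.
Variables (d : Order.disp_t) (T : finPOrderType d).

Definition is_downset (U : set T) : Prop :=
  forall x y : T, U x -> (y <= x)%O -> U y.

Let downsetT : is_downset setT. Proof. by []. Qed.

Let downsetI : setI_closed is_downset.
Proof.
by move=> A B dA dB x y [Ax Bx] yx; split; [exact: dA yx|exact: dB yx].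
Qed.

Let downset_bigU (I : Type) (f : I -> set T) :
  (forall i, is_downset (f i)) -> is_downset (\bigcup_i f i).
Proof. by move=> df x y [i _ fix_] yx; exists i => //; exact: df yx. Qed.

HB.instance Definition _ := Finite.on (downset_space T).
HB.instance Definition _ :=
  @isOpenTopological.Build (downset_space T)
    is_downset downsetT downsetI downset_bigU.

End DownsetTopology.

Section Homotopy.
Local Open Scope classical_set_scope.
Local Open Scope ring_scope.

Definition homotopic (R : realType) (X Y : topologicalType) (f g : X -> Y) :
    Prop :=
  exists H : X * R -> Y,
    [/\ {within [set: X] `*` `[0, 1], continuous H},
        forall x, H (x, 0) = f x & forall x, H (x, 1) = g x].

Definition homotopy_equivalent (R : realType) (X Y : topologicalType) : Prop :=
  exists (f : X -> Y) (g : Y -> X),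
    [/\ continuous f, continuous g,
        homotopic R (g \o f) id & homotopic R (f \o g) id].

End Homotopy.

Definition subgroup_poset (gT : finGroupType) (P : {set {group gT}}) : Type :=
  {H : {group gT} | H \in P}.

Fact subgroup_display : Order.disp_t. Proof. exact: Order.Disp tt tt. Qed.

Section SubgroupPoset.
Variables (gT : finGroupType) (P : {set {group gT}}).

HB.instance Definition _ := Finite.on (subgroup_poset P).

Definition subgroup_le (H K : subgroup_poset P) : bool :=
  sval H \subset sval K.

Let subgroup_le_refl : reflexive subgroup_le.
Proof. by move=> H; exact: subxx. Qed.

Let subgroup_le_anti : antisymmetric subgroup_le.
Proof.
move=> H K /andP[HK KH]; apply/val_inj/group_inj/eqP.
by rewrite finset.eqEsubset; apply/andP.
Qed.

Let subgroup_le_trans : transitive subgroup_le.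
Proof. by move=> K H L; exact: fintype.subset_trans. Qed.

HB.instance Definition _ :=
  Order.Le_isPOrder.Build subgroup_display (subgroup_poset P)
    subgroup_le_refl subgroup_le_anti subgroup_le_trans.

End SubgroupPoset.

Section PSubgroupSpaces.
Local Open Scope group_scope.
Variables (gT : finGroupType) (p : nat) (G : {group gT}).

Definition nontrivial_psubgroups : {set {group gT}} :=
  [set H : {group gT} | [&& H \subset G, p.-group H & H :!=: 1]].

Definition nontrivial_elementary_abelians : {set {group gT}} :=
  [set E : {group gT} | (E \in 'E_p(G)) && (E :!=: 1)].

Definition Sp_space : topologicalType :=
  downset_space (subgroup_poset nontrivial_psubgroups).

Definition Ap_space : topologicalType :=
  downset_space (subgroup_poset nontrivial_elementary_abelians).

End PSubgroupSpaces.

(* Main.v *)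
Require Import Defs.
From mathcomp Require Import all_boot all_order all_algebra.
From mathcomp Require Import all_classical all_reals topology normedtype.
From mathcomp Require Import ssrnat fintype finset all_fingroup all_solvable.

Set Implicit Arguments.
Unset Strict Implicit.
Unset Printing Implicit Defensive.

Import Order.TTheory GRing.Theory Num.Theory numFieldNormedType.Exports.

(** Let S be a Sylow p-subgroup of G. Two situations make the spaces of
    nontrivial p-subgroups and of nontrivial elementary abelian p-subgroups
    homotopy equivalent, and every group of order less than 72 falls into one
    of them.

    If S is abelian, the elements of order dividing p of a p-subgroup H form
    an elementary abelian group 'Ohm_1(H), and H |-> 'Ohm_1(H) is a monotone
    retraction lying below the identity ([homotopy_equivalent_abelian_Sylow]).

    If N = 'O_p(G) is nontrivial and of index at most p in S, both spaces are
    contractible. For all p-subgroups this is Quillen's classical fence H <=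
    HN >= N ([Sp_contractible]). For elementary abelian ones the join with N
    is not available, and one uses Z = 'Ohm_1('Z(N)) instead: an elementary
    abelian A not contained in N is first enlarged by the part of Z that
    centralises AN, after which every subgroup in sight meets N; intersecting
    with N, then joining with Z, leads to the constant map Z. The index
    hypothesis is what makes the enlargement monotone: once A leaves N, the
    group AN can no longer grow ([Ap_contractible]).

    It remains to see that |S : 'O_p(G)| divides p whenever S is not abelian
    and |G| < 72 ([abelian_or_large_pcore]). Then |S| = p^a with a >= 3, so p
    is 2 or 3. If p = 3, then |G : S| <= 2. If p = 2, then |G : S| is 1, 3, 5
    or 7. If |G : S| is a prime smaller than p^2 and S is not normal, then
    distinct conjugates of S meet in index p ([index_pcore_prime_index]). The
    indices 5 and 7 force |S| = 8, and counting Sylow subgroups of order 5 or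
    7 shows that S is normal or acts on a normal subgroup Q of prime order; in
    the latter case S / 'C_S(Q) is cyclic, which for nonabelian S is possible
    only if 'C_S(Q), a subgroup of the p-core, is large
    ([index_pcore_normal_prime]). *)

(** * Homotopies of maps between topological spaces *)

Section Homotopies.
Local Open Scope classical_set_scope.
Local Open Scope ring_scope.
Variables (R : realType) (X Y : topologicalType).
Implicit Types f g h : X -> Y.

Lemma within_continuous_precomp (S T U : topologicalType) (A : set S)
    (B : set T) (f : S -> T) (g : T -> U) :
    continuous f -> (forall x, A x -> B (f x)) ->
  {within B, continuous g} -> {within A, continuous (g \o f)}.
Proof.
move=> cf fAB /subspace_continuousP cg; apply/subspace_continuousP => x Ax.
apply: cvg_comp (cg _ (fAB _ Ax)) => W wW.
have fW : \forall y \near x, B (f y) -> W (f y) := cf x _ wW.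
suff : \forall y \near x, A y -> W (f y) by [].
by apply: filterS fW => y Wfy Ay; exact: (Wfy (fAB _ Ay)).
Qed.

Lemma continuous_reparam (phi : R -> R) : continuous phi ->
  continuous (fun z : X * R => (z.1, phi z.2)).
Proof.
move=> cphi z.
apply: (@cvg_pair _ _ _ (nbhs z) (nbhs z.1) (nbhs (phi z.2))).
  exact: cvg_fst.
by apply: (cvg_comp snd phi) (cphi _); exact: cvg_snd.
Qed.

Lemma homotopic_sym f g : homotopic R f g -> homotopic R g f.
Proof.
move=> [H [cH H0 H1]].
exists (H \o fun z => (z.1, 1 - z.2)); split => [|x|x] /=; last 2 first.
- by rewrite subr0.
- by rewrite subrr.
apply: within_continuous_precomp cH.
  apply: (@continuous_reparam (fun t => 1 - t)) => t.
  by apply: cvgB; [exact: cvg_cst | exact: cvg_id].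
move=> [x t] [_]; rewrite /= !in_itv /= => /andP[t0 t1]; split=> //.
by rewrite subr_ge0 t1 lerBlDr lerDl.
Qed.

Lemma homotopic_trans g f h :
  homotopic R f g -> homotopic R g h -> homotopic R f h.
Proof.
move=> [H [cH H0 H1]] [K [cK K0 K1]].
pose HK (z : X * R) :=
  if z.2 <= 2^-1 then H (z.1, 2 * z.2) else K (z.1, 2 * z.2 - 1).
exists HK; split=> [|x|x]; last 2 first.
- by rewrite /HK /= invr_ge0 ler0n mulr0.
- rewrite /HK /= leNgt invf_lt1 ?ltr1n //= mulr1 (_ : 2 - 1 = 1) //.
  by rewrite -[X in X - _](natrD _ 1 1) addrK.
have -> : [set: X] `*` `[0, 1] =
    [set: X] `*` `[0, 2^-1] `|` [set: X] `*` `[2^-1, (1 : R)].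
  apply/seteqP; split=> [[x t]|[x t]] /=; rewrite !in_itv /=.
    move=> [_ /andP[t0 t1]]; have [t2|/ltW t2] := leP t 2^-1.
      by left; rewrite t0.
    by right; rewrite t2.
  have le21 : 2^-1 <= 1 :> R by rewrite invf_le1 ?ler1n.
  case=> [[_ /andP[t0 t2]]|[_ /andP[t2 t1]]]; split=> //.
    by rewrite t0 (le_trans t2).
  by rewrite t1 andbT (le_trans _ t2) // invr_ge0.
have closed_strip (a b : R) : closed ([set: X] `*` `[a, b]).
  rewrite setTX; apply: preimage_closed; last exact: itv_closed.
  by case=> x t _; exact: cvg_snd.
apply: withinU_continuous; try exact: closed_strip.
- apply: (@subspace_eq_continuous _ _ _ (H \o fun z => (z.1, 2 * z.2))).
    move=> [x t] /set_mem[_]; rewrite /= in_itv /= => /andP[_ t2].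
    by rewrite /from_subspace /HK /= t2.
  apply: within_continuous_precomp cH.
    apply: (@continuous_reparam (fun t => 2 * t)) => t.
    exact: mulrl_continuous.
  move=> [x t] [_]; rewrite /= !in_itv /= => /andP[t0 t1]; split=> //.
  by rewrite mulr_ge0 //= -ler_pdivlMl // mulr1.
- apply: (@subspace_eq_continuous _ _ _ (K \o fun z => (z.1, 2 * z.2 - 1))).
    move=> [x t] /set_mem[_]; rewrite /= in_itv /= => /andP[t2 _].
    rewrite /from_subspace /HK /=; case: ifPn => // t2'.
    have -> : t = 2^-1 by apply/le_anti; rewrite t2 t2'.
    by rewrite divff ?pnatr_eq0 // subrr K0 H1.
  apply: within_continuous_precomp cK.
    apply: (@continuous_reparam (fun t => 2 * t - 1)) => t.
    by apply: cvgB; [exact: mulrl_continuous | exact: cvg_cst].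
  move=> [x t] [_]; rewrite /= !in_itv /= => /andP[t0 t1]; split=> //.
  rewrite subr_ge0 -ler_pdivrMl // mulr1 t0 /=.
  by rewrite lerBlDr -(natrD _ 1 1) -[leRHS]mulr1 ler_pM2l.
Qed.

End Homotopies.

(** * Monotone maps as continuous maps *)

Section DownsetHomotopies.
Local Open Scope classical_set_scope.
Local Open Scope ring_scope.

Lemma open_downset d (T : finPOrderType d) (U : set (downset_space T)) :
  open U <-> @is_downset d T U.
Proof. by []. Qed.

Lemma monotone_continuous d d' (S : finPOrderType d) (T : finPOrderType d')
    (f : downset_space S -> downset_space T) :
  {homo (f : S -> T) : x y / (x <= y)%O} -> continuous f.
Proof.
move=> f_mono; apply/continuousP => U /open_downset dU.
apply/open_downset => x y fUx yx.
exact: dU fUx (f_mono _ _ yx).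
Qed.

(** The homotopy is f on [0, 1[ and jumps up to g at time 1.  It is continuous
    because open sets are closed downwards: where g lies in an open set, so
    does f, hence the points sent into an open set by the homotopy are those
    where g lies in it, at any time, and those where f does, before time 1. *)
Lemma homotopic_le (R : realType) (X : topologicalType) d
    (T : finPOrderType d) (f g : X -> downset_space T) :
    continuous f -> continuous g ->
    (forall x, ((f x : T) <= g x)%O) ->
  homotopic R f g.
Proof.
move=> cf cg le_fg.
exists (fun z => if z.2 < 1 then f z.1 else g z.1).
split=> [|x|x]; rewrite /= ?ltr01 ?ltxx //.
apply: continuous_subspaceT; apply/continuousP => U dU.
suff -> : (fun z : X * R => if z.2 < 1 then f z.1 else g z.1) @^-1` U =
    (g \o fst) @^-1` U `|` ((f \o fst) @^-1` U `&` (snd @^-1` [set t | t < 1])).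
  apply: openU; last apply: openI.
  - apply: open_comp => // z _; apply: continuous_comp (cg _); exact: cvg_fst.
  - apply: open_comp => // z _; apply: continuous_comp (cf _); exact: cvg_fst.
  - by apply: open_comp; [move=> z _; exact: cvg_snd | exact: open_lt].
apply/seteqP; split=> [[x t]|[x t]] /=.
  by case: ifP => t1 Uz; [right | left].
case: ifP => t1 [Uz | [Uz t1']] //.
by move/open_downset: dU => dU; exact: dU Uz (le_fg x).
Qed.

Lemma contractible_homotopy_equivalent (R : realType) (X Y : topologicalType)
    (x0 : X) (y0 : Y) :
    homotopic R (fun=> x0) (@id X) -> homotopic R (fun=> y0) (@id Y) ->
  homotopy_equivalent R X Y.
Proof.
move=> hX hY; exists (fun=> y0), (fun=> x0).
by split=> //; exact: cst_continuous.
Qed.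

End DownsetHomotopies.

Section SubgroupMaps.
Local Open Scope group_scope.
Variable gT : finGroupType.
Implicit Types (P Q : {set {group gT}}) (H K : {group gT}).

Definition subgroup_space P := downset_space (subgroup_poset P).

Definition subgroup_point P H (PH : H \in P) : subgroup_space P :=
  exist _ H PH.

Definition subgroup_map P Q (phi : {group gT} -> {group gT})
    (PQphi : forall H, H \in P -> phi H \in Q) :
    subgroup_space P -> subgroup_space Q :=
  fun x => subgroup_point (PQphi _ (svalP x)).

Lemma subgroup_map_continuous P Q phi
    (PQphi : forall H, H \in P -> phi H \in Q) :
    {in P &, {homo phi : H K / H \subset K}} ->
  continuous (subgroup_map PQphi).
Proof.
move=> phiS; apply: monotone_continuous => H K HK.
exact: phiS (svalP H) (svalP K) HK.
Qed.

Lemma homotopic_subgroup_le (R : realType) P Q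
    (f g : subgroup_space P -> subgroup_space Q) :
    {homo (f : subgroup_poset P -> subgroup_poset Q) : x y / (x <= y)%O} ->
    {homo (g : subgroup_poset P -> subgroup_poset Q) : x y / (x <= y)%O} ->
    (forall x, sval (f x) \subset sval (g x)) ->
  homotopic R f g.
Proof.
move=> f_mono g_mono le_fg.
by apply: homotopic_le => //; exact: monotone_continuous.
Qed.

End SubgroupMaps.

(** * Two situations in which the spaces are homotopy equivalent *)

Section PSubgroups.
Local Open Scope group_scope.
Variables (R : realType) (gT : finGroupType) (p : nat) (G : {group gT}).
Implicit Types H K S N A B E : {group gT}.
Local Notation Sp := (nontrivial_psubgroups p G).
Local Notation Ap := (nontrivial_elementary_abelians p G).

Lemma psubgroupsP H :
  reflect [/\ H \subset G, p.-group H & H :!=: 1] (H \in Sp).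
Proof. by rewrite inE; exact: and3P. Qed.

Lemma elementary_abeliansP E :
  reflect [/\ E \subset G, p.-abelem E & E :!=: 1] (E \in Ap).
Proof.
rewrite inE; apply: (iffP andP) => [[/pElemP[sEG abE] ntE] | [sEG abE ntE]] //.
by split=> //; apply/pElemP.
Qed.

(** Both composites of H |-> 'Ohm_1(H) with the inclusion send a subgroup to a
    smaller one, so each is homotopic to the identity.  Every p-subgroup is
    conjugate to a subgroup of S, hence abelian, which is why its 'Ohm_1 is
    elementary abelian. *)
Lemma homotopy_equivalent_abelian_Sylow S :
    p.-Sylow(G) S -> abelian S ->
  homotopy_equivalent R (Sp_space p G) (Ap_space p G).
Proof.
move=> sylS abS.
have OhmAp H : H \in Sp -> 'Ohm_1(H)%G \in Ap.
  case/psubgroupsP=> sHG pH ntH; apply/elementary_abeliansP; split.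
  - exact: subset_trans (Ohm_sub 1 H) sHG.
  - apply: (Ohm1_abelem pH).
    have [x _ sHSx] := Sylow_Jsub sylS sHG pH.
    by rewrite -(abelianJ _ x) (abelianS sHSx).
  - by rewrite Ohm1_eq1.
have ApSp E : E \in Ap -> E \in Sp.
  case/elementary_abeliansP=> sEG /abelem_pgroup pE ntE.
  by apply/psubgroupsP.
exists (subgroup_map OhmAp), (@subgroup_map _ _ _ id ApSp); split.
- by apply: subgroup_map_continuous => H K _ _ sHK; exact: OhmS.
- exact: subgroup_map_continuous.
- apply: homotopic_subgroup_le => [H K|//|H]; first exact: OhmS.
  exact: Ohm_sub.
- apply: homotopic_subgroup_le => [H K|//|H]; first exact: OhmS.
  exact: Ohm_sub.
Qed.

(** The fence H <= HN >= N. *)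
Lemma Sp_contractible N (SpN : N \in Sp) :
    N <| G ->
  homotopic R (fun=> subgroup_point SpN : Sp_space p G) (@id (Sp_space p G)).
Proof.
move=> nsNG; have [_ pN ntN] := psubgroupsP _ SpN.
have joinSp H : H \in Sp -> (H <*> N)%G \in Sp.
  case/psubgroupsP=> sHG pH ntH; apply/psubgroupsP; split.
  - by rewrite join_subG sHG normal_sub.
  - rewrite /= norm_joinEl ?pgroupM ?pH //.
    exact: subset_trans sHG (normal_norm nsNG).
  - exact: subG1_contra (joing_subl _ _) ntH.
have join_mono H K : H \subset K -> H <*> N \subset K <*> N.
  by move=> sHK; rewrite genS ?setSU.
apply: (@homotopic_trans _ _ _ (subgroup_map joinSp)).
  apply: homotopic_subgroup_le => [//|H K|H]; first exact: join_mono.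
  exact: joing_subr.
apply: homotopic_sym; apply: homotopic_subgroup_le => [//|H K|H].
  exact: join_mono.
exact: joing_subl.
Qed.

(** Since a p-subgroup containing 'O_p(G) contains it with index 1 or p, the
    chain 'O_p(G) < A 'O_p(G) <= B 'O_p(G) leaves no room for a second proper
    inclusion. *)
Lemma join_pcore_eq S A B :
    prime p -> p.-Sylow(G) S -> #|S : 'O_p(G)| %| p ->
    B \subset G -> p.-group B -> A \subset B -> ~~ (A \subset 'O_p(G)) ->
  A <*> 'O_p(G) = B <*> 'O_p(G).
Proof.
move=> p_pr sylS dvSN sBG pB sAB nAN; set N := 'O_p(G)%G.
have nsNG : N <| G := pcore_normal p G.
have sABN : A <*> N \subset B <*> N by rewrite genS ?setSU.
have sBNG : B <*> N \subset G by rewrite join_subG sBG normal_sub.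
have pBN : p.-group (B <*> N).
  rewrite norm_joinEl ?pgroupM ?pB ?pcore_pgroup //.
  exact: subset_trans sBG (normal_norm nsNG).
have [x Gx sBNS] := Sylow_subJ sylS sBNG pBN.
have dvBN : #|B <*> N : N| %| p.
  have iSx : #|S :^ x : N| = #|S : N|.
    have sNS : N \subset S := pcore_sub_Hall sylS.
    have sNSx : N \subset S :^ x.
      by rewrite -(normP (subsetP (normal_norm nsNG) x Gx)) conjSg.
    by rewrite -!divgS // cardJg.
  apply: dvdn_trans dvSN; rewrite -iSx -(Lagrange_index sBNS (joing_subr _ _)).
  exact: dvdn_mull.
have := Lagrange_index sABN (joing_subr A N).
have : #|A <*> N : N| != 1%N by rewrite indexg_eq1 join_subG subxx andbT.
have : #|A <*> N : N| %| p.
  apply: dvdn_trans dvBN; rewrite -(Lagrange_index sABN (joing_subr A N)).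
  exact: dvdn_mull.
move=> dvA ne1; have /eqP iA : #|A <*> N : N| == p.
  exact/eqP/prime_nt_dvdP.
move=> eqi; apply/eqP; rewrite eqEsubset sABN -indexg_eq1 /=.
move: dvBN; rewrite -eqi iA -{2}[p]mul1n dvdn_pmul2r ?prime_gt0 //.
by rewrite dvdn1.
Qed.

(** With N and Z as in the proof, the fence is A <= g A >= h A <= k A >= Z.
    The group T A that g adds is nontrivial because a nontrivial normal
    subgroup of the p-group AN meets its centre; it lies in Z, hence in N, so
    that h A is nontrivial.  Finally h A, being a subgroup of N, commutes with
    the central subgroup Z, so that k A is elementary abelian.  Enlarging A by
    T A also when A is contained in N could destroy monotonicity, as T A is
    then all of Z and may shrink when A grows out of N. *)
Lemma Ap_contractible S
    (ApZ : 'Ohm_1('Z('O_p(G)))%G \in Ap) :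
    prime p -> p.-Sylow(G) S -> #|S : 'O_p(G)| %| p ->
  homotopic R (fun=> subgroup_point ApZ : Ap_space p G) (@id (Ap_space p G)).
Proof.
move=> p_pr sylS dvSN; set N := 'O_p(G)%G; set Z := 'Ohm_1('Z(N))%G.
have nsNG : N <| G := pcore_normal p G.
have [sZG abZ ntZ] := elementary_abeliansP _ ApZ.
have sZZN : Z \subset 'Z(N) := Ohm_sub 1 _.
have sZN : Z \subset N := subset_trans sZZN (center_sub _).
have nsZG : Z <| G.
  apply: char_normal_trans nsNG.
  exact: char_trans (Ohm_char 1 _) (center_char _).
pose T A := 'C_Z(A <*> N)%G.
pose g A := if A \subset N then A else (A <*> T A)%G.
pose h A := (g A :&: N)%G.
pose k A := (h A <*> Z)%G.
have g_ge A : A \subset g A.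
  by rewrite /g; case: ifP => // _; exact: joing_subl.
have gAp A : A \in Ap -> g A \in Ap.
  rewrite /g; case: ifP => // _ /elementary_abeliansP[sAG abA ntA].
  apply/elementary_abeliansP; split.
  - by rewrite join_subG sAG (subset_trans (subsetIl _ _)).
  - have cAT : T A \subset 'C(A).
      by rewrite (subset_trans (subsetIr _ _)) // centS ?joing_subl.
    rewrite (cprod_abelem _ (cprodEY cAT)) abA /=.
    exact: abelemS (subsetIl _ _) abZ.
  - exact: subG1_contra (joing_subl _ _) ntA.
have ntT A : A \in Ap -> T A :!=: 1.
  case/elementary_abeliansP=> sAG abA ntA.
  have pAN : p.-group (A <*> N).
    rewrite norm_joinEl ?pgroupM ?pcore_pgroup ?(abelem_pgroup abA) //.
    exact: subset_trans sAG (normal_norm nsNG).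
  have nsZAN : Z <| A <*> N.
    apply: normalS nsZG; first exact: subset_trans sZN (joing_subr _ _).
    by rewrite join_subG sAG normal_sub.
  apply: subG1_contra (meet_center_nil (pgroup_nil pAN) nsZAN ntZ).
  by apply: setIS; exact: subsetIr.
have hAp A : A \in Ap -> h A \in Ap.
  move=> ApA; have [sAG abA ntA] := elementary_abeliansP _ ApA.
  have [sgG abg _] := elementary_abeliansP _ (gAp A ApA).
  apply/elementary_abeliansP; split.
  - exact: subset_trans (subsetIl _ _) sgG.
  - exact: abelemS (subsetIl _ _) abg.
  - rewrite /h /g; case: ifP => [sAN | _]; first by rewrite /= (setIidPl sAN).
    apply: subG1_contra (ntT A ApA); rewrite subsetI joing_subr.
    exact: subset_trans (subsetIl _ _) sZN.
have kAp A : A \in Ap -> k A \in Ap.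
  move=> /hAp/elementary_abeliansP[shG abh nth].
  apply/elementary_abeliansP; split.
  - by rewrite join_subG shG.
  - have cZh : Z \subset 'C(h A).
      apply: subset_trans sZZN (subset_trans (subsetIr _ _) _).
      by rewrite centS // subsetIr.
    by rewrite (cprod_abelem _ (cprodEY cZh)) abh.
  - exact: subG1_contra (joing_subl _ _) nth.
have g_mono A B : B \in Ap -> A \subset B -> g A \subset g B.
  move=> /elementary_abeliansP[sBG /abelem_pgroup pB _] sAB.
  have [sAN | nAN] := boolP (A \subset N).
    by apply: subset_trans (g_ge B); rewrite /g sAN.
  have nBN : ~~ (B \subset N) by apply: contra nAN; exact: subset_trans.
  (* T depends only on the join with N, which is the same for A and B. *)
  have eqT : T A = T B.
    apply/group_inj.
    by rewrite /= (join_pcore_eq p_pr sylS dvSN sBG pB sAB nAN).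
  by rewrite /g (negPf nAN) (negPf nBN) eqT /= genS ?setSU.
have h_mono A B : B \in Ap -> A \subset B -> h A \subset h B.
  by move=> ApB sAB; apply: setSI; exact: g_mono.
have k_mono A B : B \in Ap -> A \subset B -> k A \subset k B.
  by move=> ApB sAB; rewrite genS ?setSU ?h_mono.
apply: (@homotopic_trans _ _ _ (subgroup_map kAp)).
  apply: homotopic_subgroup_le => [//|A B|A]; first exact: k_mono (svalP B).
  exact: joing_subr.
apply: (@homotopic_trans _ _ _ (subgroup_map hAp)).
  apply: homotopic_sym; apply: homotopic_subgroup_le => [A B|A B|A].
  - exact: h_mono (svalP B).
  - exact: k_mono (svalP B).
  - exact: joing_subl.
apply: (@homotopic_trans _ _ _ (subgroup_map gAp)).
  apply: homotopic_subgroup_le => [A B|A B|A].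
  - exact: h_mono (svalP B).
  - exact: g_mono (svalP B).
  - exact: subsetIl.
apply: homotopic_sym; apply: homotopic_subgroup_le => [//|A B|A].
  exact: g_mono (svalP B).
exact: g_ge.
Qed.

Lemma homotopy_equivalent_large_pcore S :
    prime p -> p.-Sylow(G) S -> 'O_p(G) != 1 -> #|S : 'O_p(G)| %| p ->
  homotopy_equivalent R (Sp_space p G) (Ap_space p G).
Proof.
move=> p_pr sylS ntN dvSN; set N := 'O_p(G)%G in ntN dvSN.
have pN : p.-group N := pcore_pgroup p G.
have sNG : N \subset G := pcore_sub p G.
have SpN : N \in Sp by apply/psubgroupsP.
have ApZ : 'Ohm_1('Z('O_p(G)))%G \in Ap.
  apply/elementary_abeliansP; split.
  - exact: subset_trans (Ohm_sub 1 _) (subset_trans (center_sub N) sNG).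
  - apply: Ohm1_abelem; last exact: center_abelian.
    exact: pgroupS (center_sub N) pN.
  - by rewrite Ohm1_eq1 center_nil_eq1 ?(pgroup_nil pN).
exact: contractible_homotopy_equivalent
  (Sp_contractible SpN (pcore_normal p G)) (Ap_contractible ApZ p_pr sylS dvSN).
Qed.

End PSubgroups.

(** * Sylow subgroups and p-cores of groups of small order *)

Section LargeCore.
Local Open Scope group_scope.
Variable gT : finGroupType.
Implicit Types (p q : nat) (G S Q : {group gT}).

(** If S is not normal, let N be its intersection with another conjugate S'.
    The product formula gives |S : N| <= |G : S| < p^2, so N has index p in S
    and in S' and is normal in both.  As S has prime index, it is a maximal
    subgroup, so S and S' generate G and N is normal in G. *)
Lemma index_pcore_prime_index p G S :
    prime p -> p.-Sylow(G) S -> prime #|G : S| -> (#|G : S| < p ^ 2)%N ->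
  #|S : 'O_p(G)| %| p.
Proof.
move=> p_pr sylS prGS ltGS.
have sSG := pHall_sub sylS; have pS := pHall_pgroup sylS.
have [nSG | /subsetPn[x Gx nSx]] := boolP (G \subset 'N(S)).
  have -> : 'O_p(G) = S by apply: normal_Hall_pcore => //; apply/andP.
  by rewrite indexgg dvd1n.
set N := (S :&: S :^ x)%G.
have sSxG : S :^ x \subset G by rewrite -(conjGid Gx) conjSg.
have neqS : S :^ x != S by apply: contra nSx => /eqP eS; apply/normP.
have pidx : #|S : N| = p.
  have leGS : (#|S : N| <= #|G : S|)%N.
    rewrite -(leq_pmul2r (cardG_gt0 N)) -(leq_pmul2l (cardG_gt0 S)).
    rewrite [(#|S : N| * _)%N]mulnC Lagrange ?subsetIl // mulnA Lagrange //.
    rewrite -[X in (_ * X <= _)%N](cardJg S x) [leqLHS]mul_cardG leq_mul2r.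
    by rewrite subset_leq_card ?orbT // mul_subG.
  have [k defk] : {k | #|S : N| = (p ^ k)%N}.
    by apply: p_natP; apply: pnat_dvd pS; apply: dvdn_indexg.
  have k_gt0 : (0 < k)%N.
    rewrite lt0n; apply: contra neqS => /eqP k0; move: defk; rewrite k0.
    move/eqP; rewrite indexg_eq1 => sSN.
    have sSSx : S \subset S :^ x by rewrite (subset_trans sSN) ?subsetIr.
    by rewrite eq_sym eqEcard sSSx cardJg leqnn.
  have k_lt2 : (k < 2)%N.
    by rewrite -(ltn_exp2l _ _ (prime_gt1 p_pr)) -defk (leq_ltn_trans leGS).
  by rewrite defk; case: k k_gt0 k_lt2 {defk} => [|[|k]].
have nNS : S \subset 'N(N).
  apply/normal_norm/(@p_maximal_normal _ p) => //.
  by apply: p_index_maximal; rewrite ?subsetIl ?pidx.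
have nNSx : S :^ x \subset 'N(N).
  apply/normal_norm/(@p_maximal_normal _ p); first by rewrite pgroupJ.
  apply: p_index_maximal; rewrite ?subsetIr //.
  suff -> : #|S :^ x : N| = #|S : N| by rewrite pidx.
  by rewrite -!divgS ?subsetIl ?subsetIr // cardJg.
have defG : S <*> S :^ x = G.
  have sJG : S <*> S :^ x \subset G by rewrite join_subG sSG.
  have /maxgroupP[_ maxS] := p_index_maximal sSG prGS.
  apply/eqP; rewrite eqEproper sJG /=; apply: contra neqS => prJ.
  have defJ := maxS (S <*> S :^ x)%G prJ (joing_subl _ _).
  by rewrite eqEcard cardJg leqnn andbT -{2}defJ joing_subr.
have sNO : N \subset 'O_p(G).
  apply: pcore_max; first exact: pgroupS (subsetIl _ _) pS.
  rewrite /normal (subset_trans (subsetIl _ _) sSG) /= -defG join_subG.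
  by rewrite nNS nNSx.
by apply: dvdn_trans (indexgS S sNO) _; rewrite pidx.
Qed.

(** The centraliser K of Q in S is normalised by S and centralised by Q, so it
    lies in the p-core, and S / K is cyclic because it embeds in Aut Q.  If
    |K| <= p, then K is central in S, and a group that is cyclic modulo a
    central subgroup is abelian.  Otherwise |K| >= p^2 and |S : K| <= p. *)
Lemma index_pcore_normal_prime p G S Q :
    prime p -> p.-Sylow(G) S -> #|S| = (p ^ 3)%N ->
    Q <| G -> prime #|Q| -> Q * S = G ->
  abelian S \/ #|S : 'O_p(G)| %| p.
Proof.
move=> p_pr sylS oS nsQG prQ defG.
have sSG := pHall_sub sylS; have pS := pHall_pgroup sylS.
have nQS : S \subset 'N(Q) by rewrite (subset_trans sSG) ?normal_norm.
set K := 'C_S(Q)%G.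
have sKS : K \subset S := subsetIl _ _.
have nKS : S \subset 'N(K) by rewrite normsI ?normG ?norms_cent.
have nsKS : K <| S by apply/andP.
have cycSK : cyclic (S / K).
  have -> : K = ('ker_S (conj_aut Q))%G.
    by apply/group_inj; rewrite /= ker_conj_aut.
  rewrite (isog_cyclic (first_isog_loc _ nQS)).
  exact: cyclicS (Aut_conj_aut _ _) (Aut_prime_cyclic prQ).
have sKO : K \subset 'O_p(G).
  apply: pcore_max; first exact: pgroupS sKS pS.
  rewrite /normal (subset_trans sKS sSG) /= -defG mul_subG //.
  by rewrite cents_norm // centsC subsetIr.
have [k oK] : {k | #|K| = (p ^ k)%N} by apply: p_natP; apply: pgroupS pS.
have [k_le1 | k_gt1] := leqP k 1.
  left; apply: (cyclic_factor_abelian _ cycSK).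
  have [-> | ntK] := eqVneq (K : {set gT}) 1; first exact: sub1G.
  have prK : prime #|K|.
    rewrite oK; case: k k_le1 oK => [|[|//]] _ oK; last by [].
    by case/eqP: ntK; apply: card1_trivg.
  apply: (prime_meetG prK).
  by apply: meet_center_nil => //; apply: pgroup_nil pS.
right; apply: dvdn_trans (indexgS _ sKO) _.
rewrite -divgS // oS oK -expnB ?prime_gt0 //.
  by rewrite -{2}[p]expn1 dvdn_exp2l // (leq_sub2l 3 k_gt1).
by rewrite -(dvdn_Pexp2l _ _ (prime_gt1 p_pr)) -oK -oS cardSg.
Qed.

(** The number of conjugates of Q is congruent to 1 modulo q and divides q + 1.
    If it is q + 1, then Q is its own normaliser, and its conjugates, meeting
    trivially, contain q^2 - 1 elements of order q altogether.  The q + 1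
    remaining elements form a set normalised by G, and S, whose order is prime
    to q, must be equal to it. *)
Lemma normal_Sylow_or_complement q G Q S :
    prime q -> q.-Sylow(G) Q -> #|Q| = q ->
    S \subset G -> #|S| = q.+1 -> #|G| = (q * q.+1)%N ->
  Q <| G \/ S <| G.
Proof.
move=> q_pr sylQ oQ sSG oS oG.
have sQG := pHall_sub sylQ.
have prQ : prime #|Q| by rewrite oQ.
have sQN : Q \subset 'N_G(Q) by rewrite subsetI sQG normG.
have nsyl : #|G : 'N_G(Q)| = (#|G : 'N_G(Q)| %/ q * q).+1.
  have := card_Syl_mod G q_pr; rewrite (card_Syl sylQ) => modq.
  by rewrite {1}(divn_eq #|G : _| q) modq addn1.
have oN : (#|G : 'N_G(Q)| * #|'N_G(Q) : Q|)%N = q.+1.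
  apply/eqP; rewrite Lagrange_index ?subsetIl // -divgS // oG oQ.
  by rewrite mulKn ?prime_gt0.
move: (#|G : _| %/ q) nsyl => [|k] nsyl.
  left; rewrite /normal sQG; apply/setIidPl/eqP.
  by rewrite eqEsubset subsetIl -indexg_eq1 nsyl.
have iN1 : #|'N_G(Q) : Q| = 1%N.
  apply/eqP; rewrite eqn_leq indexg_gt0 andbT leqNgt; apply/negP => gt1.
  have : (q.+1 * 2 <= q.+1)%N.
    by rewrite -{2}oN leq_mul // nsyl ltnS mulSn leq_addr.
  by rewrite muln2 -addnn -[leqRHS]addn0 leq_add2l.
have defN : 'N_G(Q) = Q.
  by apply/eqP; rewrite eqEsubset sQN -indexg_eq1 iN1.
have iQ : #|G : Q| = q.+1 by rewrite -oN iN1 muln1 defN.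
have tiQ : normedTI Q^# G Q.
  apply/normedTI_P; split.
  - by rewrite setD_eq0 subG1 trivg_card1 oQ neq_ltn prime_gt1 ?orbT.
  - by rewrite normD1 defN.
  move=> g Gg /pred0Pn[x /andP[/setD1P[ntx Qx]]].
  rewrite conjD1g => /setD1P[_ Qgx].
  rewrite -defN inE Gg; apply/normP/esym/eqP.
  rewrite eqEcard cardJg leqnn andbT prime_meetG //=.
  by apply/trivgPn; exists x => //; apply/setIP.
right; suff -> : S = G :\: class_support Q^# G :> {set gT}.
  by rewrite /normal subsetDl normsD ?normG // class_support_norm.
apply/eqP; rewrite eqEcard; apply/andP; split.
  apply/subsetP=> x Sx; rewrite inE (subsetP sSG) // andbT.
  apply/negP => /imset2P[y z /setD1P[nty Qy] Gz defx].
  have := order_dvdG Sx; rewrite defx orderJ oS => dv.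
  have := order_dvdG Qy; rewrite oQ => dvq.
  case/negP: nty; rewrite -order_eq1 -dvdn1.
  by rewrite -(eqP (coprimenS q)) dvdn_gcd dvq.
rewrite cardsD (setIidPr _); last first.
  by apply: class_support_subG; apply: subset_trans (subsetDl _ _) sQG.
rewrite (card_support_normedTI tiQ) iQ oG oS.
have -> : #|Q^#| = q.-1 by rewrite -oQ (cardsD1 1 Q) group1.
by rewrite -mulnBl; case: (q) q_pr => [|[|n]] //= _; rewrite subSnn mul1n.
Qed.

Lemma abelian_or_large_pcore p G S :
    prime p -> (#|G| < 72)%N -> p.-Sylow(G) S ->
  abelian S \/ #|S : 'O_p(G)| %| p.
Proof.
move=> p_pr ltG sylS; have sSG := pHall_sub sylS; have pS := pHall_pgroup sylS.
have [a oS] : {a | #|S| = (p ^ a)%N} by apply: p_natP.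
have [a_le2 | a_gt2] := leqP a 2.
  by left; apply: (p2group_abelian pS); rewrite oS pfactorK.
have oG : #|G| = (p ^ a * #|G : S|)%N by rewrite -oS Lagrange.
have p'm : ~~ (p %| #|G : S|) by rewrite -p'natE //; case/and3P: sylS.
have large_prime : prime #|G : S| -> (#|G : S| < p ^ 2)%N ->
    abelian S \/ #|S : 'O_p(G)| %| p.
  by move=> prm ltm; right; apply: index_pcore_prime_index.
have large_normal : S <| G -> abelian S \/ #|S : 'O_p(G)| %| p.
  by right; rewrite (normal_Hall_pcore sylS) // indexgg dvd1n.
have large_whole : #|G : S| = 1%N -> abelian S \/ #|S : 'O_p(G)| %| p.
  move/eqP; rewrite indexg_eq1 => sGS; apply: large_normal.
  by rewrite /normal sSG (subset_trans sGS) ?normG.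
move: ltG; rewrite oG => ltG.
have p3m : (p ^ 3 * #|G : S| < 72)%N.
  by apply: leq_ltn_trans ltG; rewrite leq_mul2r leq_pexp2l ?prime_gt0 ?orbT.
(* The cube of 5 is already larger than 72. *)
have p_lt5 : (p < 5)%N.
  rewrite -(ltn_exp2r _ _ (isT : 0 < 3)%N).
  by apply: leq_ltn_trans (ltn_trans p3m _); rewrite ?leq_pmulr ?indexg_gt0.
have Sylow_q q : prime q -> #|G : S| = q ->
    exists2 Q : {group gT}, q.-Sylow(G) Q & #|Q| = q.
  move=> q_pr iS; have [Q sylQ] := Sylow_exists q G; exists Q => //.
  have neqp : p != q by rewrite -dvdn_prime2 // -iS.
  rewrite (card_Hall sylQ) oG iS partnM ?expn_gt0 ?prime_gt0 //.
  rewrite partnX part_p'nat ?exp1n ?mul1n ?part_pnat_id ?pnat_id //.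
  by rewrite pnatE // inE.
have large_normal_q q Q : a = 3 -> #|G : S| = q -> prime q -> #|Q| = q ->
    Q <| G -> abelian S \/ #|S : 'O_p(G)| %| p.
  move=> a3 iS q_pr oQ nsQG; have sQG := normal_sub nsQG.
  apply: (@index_pcore_normal_prime p G S Q) => //; rewrite ?oS ?a3 ?oQ //.
  have coQS : coprime #|Q| #|S|.
    by rewrite oQ oS coprimeXr // prime_coprime // dvdn_prime2 // eq_sym
               -dvdn_prime2 // -iS.
  apply/eqP; rewrite eqEcard mul_subG //= coprime_cardMg // oG oS oQ iS.
  by rewrite mulnC.
(* Otherwise |G| would be at least 16 * 5 = 80. *)
have a_eq3 : (4 < #|G : S|)%N -> a = 3.
  move=> m_gt4; apply/eqP; rewrite eqn_leq a_gt2 andbT leqNgt.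
  apply/negP => a_gt3.
  have : (2 ^ 4 * 5 <= p ^ a * #|G : S|)%N.
    rewrite leq_mul // (@leq_trans (p ^ 4)) ?leq_pexp2l ?prime_gt0 //.
    by rewrite leq_exp2r // prime_gt1.
  by rewrite leqNgt (ltn_trans ltG).
have [p2 | p3] : p = 2 \/ p = 3.
  by case: (p) p_pr p_lt5 => [|[|[|[|[|]]]]] // _ _; [left | right].
- subst p; have : (#|G : S| < 9)%N by rewrite -(ltn_pmul2l (isT : 0 < 2 ^ 3)%N).
  case: #|G : S| p'm large_prime large_whole Sylow_q large_normal_q a_eq3 oG =>
    [|[|[|[|[|[|[|[|[|m]]]]]]]]] //= _ lp lw sq lnq a3 oG _.
  + exact: lw.
  + exact: lp.
  + have [Q sylQ oQ] := sq 5 isT erefl.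
    apply: (lnq 5 Q (a3 isT) erefl isT oQ).
    have dvd40 : #|'Syl_5(G)| \in divisors 40.
      by rewrite -dvdn_divisors // (_ : 40 = #|G|) ?card_Syl_dvd // oG (a3 isT).
    (* The only divisor of 40 congruent to 1 modulo 5 is 1. *)
    have := card_Syl_mod G (isT : prime 5).
    rewrite (card_Syl sylQ) in dvd40 *.
    case: (#|G : 'N_G(Q)| =P 1%N) => [/eqP|]; last first.
      by move: dvd40; rewrite !inE; do ![case/orP=> [/eqP-> //|]] => /eqP->.
    by rewrite indexg_eq1 subsetI subxx /normal (pHall_sub sylQ) => ->.
  + have [Q sylQ oQ] := sq 7 isT erefl.
    have oS8 : #|S| = 8 by rewrite oS (a3 isT).
    have oG56 : #|G| = (7 * 8)%N by rewrite oG (a3 isT).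
    case: (@normal_Sylow_or_complement 7 G Q S isT sylQ oQ sSG oS8 oG56).
      exact: (lnq 7 Q (a3 isT) erefl isT oQ).
    exact: large_normal.
- subst p; have : (#|G : S| < 3)%N.
    by rewrite -(ltn_pmul2l (isT : 0 < 3 ^ 3)%N) (ltn_trans p3m).
  case: #|G : S| p'm large_prime large_whole => [|[|[|m]]] //= _ lp lw _.
  + exact: lw.
  + exact: lp.
Qed.

End LargeCore.

Theorem proposition3p8 (R : realType) (gT : finGroupType) (G : {group gT})
    (hG : (#|G| < 72)%N) (p : nat) (hp : prime p) :
  homotopy_equivalent R (Sp_space p G) (Ap_space p G).
Proof.
have [S sylS] := Sylow_exists p G; have pS := pHall_pgroup sylS.
have [abS | dvSN] := abelian_or_large_pcore hp hG sylS.
  exact: homotopy_equivalent_abelian_Sylow sylS abS.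
(* If the p-core is trivial, then |S| divides p and S is abelian after all. *)
have [N1 | ntN] := eqVneq ('O_p(G))%g 1%g; last first.
  exact: homotopy_equivalent_large_pcore hp sylS ntN dvSN.
apply: homotopy_equivalent_abelian_Sylow sylS _.
apply: (p2group_abelian pS); move: dvSN; rewrite N1 indexg1 => dvS.
rewrite (leq_trans (dvdn_leq_log p (prime_gt0 hp) dvS)) //.
by rewrite logn_prime // eqxx.
Qed.
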